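(* Let $\tau\in\mathrm{UEBTP}(d)$ and define $F_0(\tau)=\{\mathrm{Ad}_B: B\in\mathbb{M}_d,\ \mathrm{rank}(B)=1,\ \mathrm{Ad}_B\preccurlyeq_{EB}\tau\}$. Let $\{\mathrm{Ad}_{B_k}\}_{k=1}^n\subseteq F_0(\tau)$ be a basis of the real vector space $\mathcal{V}_\tau=\mathrm{span}_{\mathbb{R}}F_0(\tau)$. Then the following are equivalent: (1) $\tau$ is an extreme point of $\mathrm{UEBTP}(d)$; (2) the operators $\{B_kB_k^*\oplus B_k^*B_k\}_{k=1}^n\subseteq\mathbb{M}_d\oplus\mathbb{M}_d$ are linearly independent.
   Context: $\mathbb{M}_d$ is the algebra of $d\times d$ complex matrices. A quantum channel on $\mathbb{M}_d$ is a completely positive, trace-preserving linear map. A linear map $\varphi$ on $\mathbb{M}_d$ is entanglement breaking (EB) if for every $k\ge 1$ and every positive semidefinite $Z\in\mathbb{M}_d\otimes\mathbb{M}_k$, the matrix $(\varphi\otimes\mathrm{id}_k)(Z)$ is separable, i.e. a finite sum of $X_j\otimes Y_j$ with $X_j,Y_j$ positive semidefinite; equivalently, $\varphi=\sum_{j}\mathrm{Ad}_{V_j}$ (finite sum) with rank-one matrices $V_j$, where $\mathrm{Ad}_V(X)=VXV^*$. $\mathrm{EB}(d)$ is the set of all EB maps on $\mathbb{M}_d$, and $\mathrm{UEBTP}(d)$ is the (compact, convex) set of all unital EB quantum channels on $\mathbb{M}_d$. For $\sigma,\tau\in\mathrm{EB}(d)$, $\sigma\preccurlyeq_{EB}\tau$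 means $\tau-\sigma\in\mathrm{EB}(d)$. *)

(* Defs.v *)
From HB Require Import structures.
From mathcomp Require Import all_boot all_order all_algebra.
From mathcomp Require Import mathcomp_extra boolp classical_sets reals.
From mathcomp Require Export spectral complex mxtens.

Set Implicit Arguments.
Unset Strict Implicit.
Unset Printing Implicit Defensive.

Import Order.TTheory GRing.Theory Num.Theory.

Local Open Scope classical_set_scope.
Local Open Scope ring_scope.
Local Open Scope sesquilinear_scope.
Local Open Scope complex_scope.

Section RealSpan.
Variables (R : realType) (V : lmodType R[i]).

Definition real_comb (m : nat) (c : 'I_m -> R) (v : 'I_m -> V) : V :=
  \sum_(i < m) (c i)%:C *: v i.

Definition real_span (S : set V) : set V :=
  [set x | exists (m : nat) (c : 'I_m -> R) (v : 'I_m -> V),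
     (forall i, S (v i)) /\ x = real_comb c v].

Definition real_basis (U : set V) (n : nat) (v : 'I_n -> V) : Prop :=
  [/\ forall k, U (v k),
      forall c : 'I_n -> R, real_comb c v = 0 -> forall k, c k = 0
    & forall x, U x -> exists c : 'I_n -> R, x = real_comb c v].

Definition extreme_point (K : set V) (x : V) : Prop :=
  K x /\ forall (y z : V) (t : R), K y -> K z -> 0 < t < 1 ->
    x = t%:C *: y + (1 - t)%:C *: z -> y = x /\ z = x.

End RealSpan.

Section Channels.
Variable R : realType.
Local Notation C := R[i].

Definition psdmx (m : nat) (A : 'M[C]_m) : Prop :=
  A^t* = A /\ forall u : 'cV[C]_m, 0 <= (u^t* *m A *m u) 0 0.

(* M_d (x) M_k is 'M_(d * k), with Kronecker product [*t]. *)
Definition separablemx (d k : nat) (Z : 'M[C]_(d * k)) : Prop :=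
  exists (m : nat) (X : 'I_m -> 'M[C]_d) (Y : 'I_m -> 'M[C]_k),
    (forall j, psdmx (X j) /\ psdmx (Y j)) /\ Z = \sum_(j < m) X j *t Y j.

(* Coefficient of Z on the matrix unit E_ij of the second factor:
   Z = \sum_(i, j) tens_coef Z i j *t E_ij. *)
Definition tens_coef (d k : nat) (Z : 'M[C]_(d * k)) (i j : 'I_k) : 'M[C]_d :=
  \matrix_(a, b) Z (mxtens_index (a, i)) (mxtens_index (b, j)).

(* phi (x) id_k; see [ampliationD], [ampliationZ] and [ampliation_tens]. *)
Definition ampliation (d k : nat) (phi : 'End('M[C]_d)) (Z : 'M[C]_(d * k)) :
    'M[C]_(d * k) :=
  \sum_(i < k) \sum_(j < k) phi (tens_coef Z i j) *t delta_mx i j.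

Lemma tensmxDl (d k : nat) (X Y : 'M[C]_d) (E : 'M[C]_k) :
  (X + Y) *t E = X *t E + Y *t E.
Proof. by apply/matrixP => a b; rewrite !mxE mulrDl. Qed.

Lemma tensmxZl (d k : nat) a (X : 'M[C]_d) (E : 'M[C]_k) :
  (a *: X) *t E = a *: (X *t E).
Proof. by apply/matrixP => i j; rewrite !mxE mulrA. Qed.

Lemma ampliationD (d k : nat) (phi : 'End('M[C]_d)) (Z W : 'M[C]_(d * k)) :
  ampliation phi (Z + W) = ampliation phi Z + ampliation phi W.
Proof.
rewrite -big_split; apply: eq_bigr => i _; rewrite -big_split.
apply: eq_bigr => j _ /=; rewrite -tensmxDl -linearD; congr (phi _ *t _).
by apply/matrixP => a b; rewrite !mxE.
Qed.

Lemma ampliationZ (d k : nat) (phi : 'End('M[C]_d)) a (Z : 'M[C]_(d * k)) :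
  ampliation phi (a *: Z) = a *: ampliation phi Z.
Proof.
rewrite scaler_sumr; apply: eq_bigr => i _; rewrite scaler_sumr.
apply: eq_bigr => j _; rewrite -tensmxZl -linearZ; congr (phi _ *t _).
by apply/matrixP => b c; rewrite !mxE.
Qed.

Lemma ampliation_tens (d k : nat) (phi : 'End('M[C]_d))
    (X : 'M[C]_d) (Y : 'M[C]_k) :
  ampliation phi (X *t Y) = phi X *t Y.
Proof.
have coefE i j : tens_coef (X *t Y) i j = Y i j *: X.
  by apply/matrixP => a b; rewrite !mxE !mxtens_indexK mulrC.
apply/matrixP => p q; rewrite [RHS]mxE.
rewrite {2}(matrix_sum_delta Y) !summxE mulr_sumr; apply: eq_bigr => i _.
rewrite !summxE mulr_sumr; apply: eq_bigr => j _.
by rewrite coefE linearZ !mxE /= !mulrA; congr (_ * _); rewrite mulrC.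
Qed.

Definition completely_positive (d : nat) (phi : 'End('M[C]_d)) : Prop :=
  forall k : nat, (0 < k)%N -> forall Z : 'M[C]_(d * k),
    psdmx Z -> psdmx (ampliation phi Z).

Definition trace_preserving (d : nat) (phi : 'End('M[C]_d)) : Prop :=
  forall X : 'M[C]_d, \tr (phi X) = \tr X.

Definition quantum_channel (d : nat) (phi : 'End('M[C]_d)) : Prop :=
  completely_positive phi /\ trace_preserving phi.

Definition unital (d : nat) (phi : 'End('M[C]_d)) : Prop :=
  phi 1%:M = 1%:M.

Definition EB (d : nat) : set 'End('M[C]_d) :=
  [set phi | forall k : nat, (0 < k)%N -> forall Z : 'M[C]_(d * k),
     psdmx Z -> separablemx (ampliation phi Z)].

Definition UEBTP (d : nat) : set 'End('M[C]_d) :=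
  [set phi | [/\ quantum_channel phi, unital phi & EB phi]].

Definition EB_le (d : nat) (sigma tau : 'End('M[C]_d)) : Prop :=
  [/\ EB sigma, EB tau & EB (tau - sigma)].

Definition Ad (d : nat) (V : 'M[C]_d) : 'End('M[C]_d) :=
  linfun (mulmxr (V^t*) \o mulmx V).

Lemma AdE (d : nat) (V X : 'M[C]_d) : Ad V X = V *m X *m V^t*.
Proof. by rewrite lfunE. Qed.

Definition F0 (d : nat) (tau : 'End('M[C]_d)) : set 'End('M[C]_d) :=
  [set Ad B | B in [set B : 'M[C]_d | \rank B = 1%N /\ EB_le (Ad B) tau]].

End Channels.

(* Main.v *)
(** Every EB map is a sum of rank-one [Ad V], so an EB map below [tau] lies in
    the real span of [F0 tau], i.e. is a real combination of the [Ad (B k)].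
    Such a combination [phi] satisfies [phi 1 = 0] and [\tr (phi X) = 0] for
    all [X] exactly when its coefficients give a real relation between the
    operators [B k (B k)^* (+) (B k)^* B k].  Hence a relation provides a
    segment [tau +- eps phi] of unital EB channels through [tau] (EB because
    [tau - Ad (B k)] and [Ad (B k)] are); conversely, if
    [tau = t y + (1 - t) z] then [t y] and [(1 - t) z] are below [tau], so
    [y - z] provides a relation. *)
Require Import Defs.
From mathcomp Require Import all_boot all_order all_algebra.
From mathcomp Require Import classical_sets reals.

Local Open Scope ring_scope.
Local Open Scope sesquilinear_scope.

Import Order.TTheory GRing.Theory Num.Theory.

Set Implicit Arguments.
Unset Strict Implicit.
Unset Printing Implicit Defensive.

(** * Positive semidefinite matrices: closure properties and Gram factorization *)

Section PositiveSemidefinite.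
Variable R : realType.
Local Notation C := R[i].

Lemma adjmxM m n p (A : 'M[C]_(m, n)) (B : 'M[C]_(n, p)) :
  (A *m B)^t* = B^t* *m A^t*.
Proof. by rewrite trmx_mul map_mxM. Qed.

Lemma adjmxD m n (A B : 'M[C]_(m, n)) : (A + B)^t* = A^t* + B^t*.
Proof. by apply/matrixP => i j; rewrite !mxE rmorphD. Qed.

Lemma adjmxZ m n a (A : 'M[C]_(m, n)) : (a *: A)^t* = a^* *: A^t*.
Proof. by apply/matrixP => i j; rewrite !mxE rmorphM. Qed.

Lemma adjmx_sum m n (I : finType) (F : I -> 'M[C]_(m, n)) :
  (\sum_i F i)^t* = \sum_i (F i)^t*.
Proof.
apply: (big_morph (fun A : 'M[C]_(m, n) => A^t*)) => [A B|]; first exact: adjmxD.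
by apply/matrixP => i j; rewrite !mxE rmorph0.
Qed.

Lemma psdmx_gram m n (Q : 'M[C]_(m, n)) : psdmx (Q^t* *m Q).
Proof.
split=> [|u]; first by rewrite adjmxM trmxCK.
rewrite mulmxA -adjmxM -mulmxA !mxE sumr_ge0 // => i _.
by rewrite !mxE mulrC mul_conjC_ge0.
Qed.

Lemma psdmxD m (A B : 'M[C]_m) : psdmx A -> psdmx B -> psdmx (A + B).
Proof.
move=> [Ah Ap] [Bh Bp]; split=> [|u]; first by rewrite adjmxD Ah Bh.
by rewrite mulmxDr mulmxDl mxE addr_ge0.
Qed.

Lemma psdmx0 m : psdmx (0 : 'M[C]_m).
Proof.
split=> [|u]; last by rewrite mulmx0 mul0mx mxE.
by apply/matrixP => i j; rewrite !mxE rmorph0.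
Qed.

Lemma psdmx_sum m (I : finType) (F : I -> 'M[C]_m) :
  (forall i, psdmx (F i)) -> psdmx (\sum_i F i).
Proof. by move=> Fp; apply: big_ind => //; [exact: psdmx0 | exact: psdmxD]. Qed.

Lemma psdmxZ m a (A : 'M[C]_m) : 0 <= a -> psdmx A -> psdmx (a *: A).
Proof.
move=> a0 [Ah Ap]; split=> [|u].
  by rewrite adjmxZ Ah conj_Creal // ger0_real.
by rewrite -scalemxAr -scalemxAl mxE mulr_ge0.
Qed.

Lemma psdmx_conj m n (W : 'M[C]_(m, n)) (Z : 'M[C]_n) :
  psdmx Z -> psdmx (W *m Z *m W^t*).
Proof.
move=> [Zh Zp]; split=> [|u]; first by rewrite !adjmxM trmxCK Zh mulmxA.
have := Zp (W^t* *m u); by rewrite adjmxM trmxCK !mulmxA.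
Qed.

(** Diagonalize [A] by a unitary [P] and take square roots of the eigenvalues: [Q] is sqrt(D) P. *)
Lemma psdmx_sqrt m (A : 'M[C]_m) : psdmx A ->
  exists Q : 'M[C]_m, A = Q^t* *m Q.
Proof.
move=> [Ah Ap].
have Aherm : A \is hermsymmx by rewrite is_hermitianmxE expr0 scale1r Ah.
have [P [D [PU A_eq]]] : exists (P : 'M[C]_m) (D : 'rV[C]_m),
    P *m P^t* = 1%:M /\ A = P^t* *m diag_mx D *m P.
  exists (spectralmx A), (spectral_diag A).
  have PU := spectral_unitarymx A; split; first exact/unitarymxP.
  by rewrite -invmx_unitary //; exact/orthomx_spectralP/hermitian_normalmx.
(* Each eigenvalue is the value of the quadratic form of [A] at the corresponding unit eigenvector,
   the adjoint of a row of [P]. *)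
have D_ge0 i : 0 <= D 0 i.
  suff <- : ((row i P)^t*^t* *m A *m (row i P)^t*) 0 0 = D 0 i by apply: Ap.
  have -> : (row i P)^t* = P^t* *m delta_mx i 0.
    by rewrite rowE adjmxM trmx_delta map_delta_mx.
  rewrite adjmxM trmxCK A_eq !mulmxA -[_ *m P *m P^t*]mulmxA PU mulmx1.
  rewrite -[_ *m P *m P^t*]mulmxA PU mulmx1 trmx_delta map_delta_mx.
  by rewrite -rowE -colE !mxE eqxx mulr1n.
exists (diag_mx (map_mx sqrtC D) *m P).
rewrite adjmxM !mulmxA -[_ *m diag_mx _]mulmxA A_eq; congr (_ *m _ *m _).
apply/matrixP => i j; rewrite [RHS]mxE (bigD1 i) //= big1 ?addr0 => [|k ki].
  rewrite !mxE eqxx mulr1n conj_Creal ?ger0_real ?sqrtC_ge0 //.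
  by case: (i == j); rewrite ?mulr0n ?mulr0 // !mulr1n -expr2 sqrtCK.
by rewrite !mxE (negPf ki) mulr0n rmorph0 mul0r.
Qed.

(** A Kronecker product of Gram matrices is the Gram matrix of the Kronecker product of the
    factors. *)
Lemma psdmx_tens m n (A : 'M[C]_m) (B : 'M[C]_n) :
  psdmx A -> psdmx B -> psdmx (A *t B).
Proof.
move=> /psdmx_sqrt[P ->] /psdmx_sqrt[Q ->]; rewrite -tensmx_mul.
suff <- : (P *t Q)^t* = P^t* *t Q^t* by exact: psdmx_gram.
by apply/matrixP => i j; rewrite !mxE rmorphM.
Qed.

End PositiveSemidefinite.

(** * The cone of EB maps and its rank-one Kraus decompositions *)

Section EntanglementBreaking.
Variable R : realType.
Local Notation C := R[i].

Lemma separablemx0 d k : separablemx (0 : 'M[C]_(d * k)).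
Proof.
exists 0%N, (fun=> 0), (fun=> 0); split; first by case.
by rewrite big_ord0.
Qed.

Lemma separablemxD d k (Z W : 'M[C]_(d * k)) :
  separablemx Z -> separablemx W -> separablemx (Z + W).
Proof.
move=> [m [X [Y [XY ->]]]] [m' [X' [Y' [XY' ->]]]]; exists (m + m')%N.
exists (fun j => match split j with inl i => X i | inr i => X' i end).
exists (fun j => match split j with inl i => Y i | inr i => Y' i end).
split=> [j|]; first by case: (split j).
rewrite big_split_ord /=; congr (_ + _); apply: eq_bigr => j _.
  by rewrite -[lshift _ _]/(unsplit (inl j)) unsplitK.
by rewrite -[rshift _ _]/(unsplit (inr j)) unsplitK.
Qed.

Lemma separablemxZ d k a (Z : 'M[C]_(d * k)) :
  0 <= a -> separablemx Z -> separablemx (a *: Z).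
Proof.
move=> a0 [m [X [Y [XY ->]]]]; exists m, (fun j => a *: X j), Y; split=> [j|].
  by have [? ?] := XY j; split=> //; exact: psdmxZ.
by rewrite scaler_sumr; apply: eq_bigr => j _; rewrite tensmxZl.
Qed.

Lemma separablemx_psd d k (Z : 'M[C]_(d * k)) : separablemx Z -> psdmx Z.
Proof.
move=> [m [X [Y [XY ->]]]]; apply: psdmx_sum => j.
by have [? ?] := XY j; exact: psdmx_tens.
Qed.

Lemma ampliationE d k (phi : 'End('M[C]_d)) (Z : 'M[C]_(d * k)) a i b j :
  ampliation phi Z (mxtens_index (a, i)) (mxtens_index (b, j))
  = phi (tens_coef Z i j) a b.
Proof.
rewrite summxE (bigD1 i) //= [X in _ + X]big1 => [|i' ii'].
  rewrite addr0 summxE (bigD1 j) //= [X in _ + X]big1 => [|j' jj'].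
    by rewrite addr0 tensmxE mxE !eqxx mulr1.
  by rewrite tensmxE mxE eqxx eq_sym (negPf jj') mulr0.
rewrite summxE big1 // => j' _.
by rewrite tensmxE mxE eq_sym (negPf ii') mulr0.
Qed.

Lemma ampliation_fun0 d k (Z : 'M[C]_(d * k)) :
  ampliation (0 : 'End('M[C]_d)) Z = 0.
Proof.
apply: big1 => i _; apply: big1 => j _.
by rewrite lfunE /= tens0mx.
Qed.

Lemma ampliation_funD d k (phi psi : 'End('M[C]_d)) (Z : 'M[C]_(d * k)) :
  ampliation (phi + psi) Z = ampliation phi Z + ampliation psi Z.
Proof.
rewrite -big_split; apply: eq_bigr => i _; rewrite -big_split.
by apply: eq_bigr => j _ /=; rewrite lfunE /= tensmxDl.
Qed.

Lemma ampliation_funZ d k a (phi : 'End('M[C]_d)) (Z : 'M[C]_(d * k)) :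
  ampliation (a *: phi) Z = a *: ampliation phi Z.
Proof.
rewrite scaler_sumr; apply: eq_bigr => i _; rewrite scaler_sumr.
by apply: eq_bigr => j _ /=; rewrite lfunE /= tensmxZl.
Qed.

Lemma EB0 d : EB (0 : 'End('M[C]_d)).
Proof. by move=> k k0 Z Zp; rewrite ampliation_fun0; exact: separablemx0. Qed.

Lemma EBD d (phi psi : 'End('M[C]_d)) : EB phi -> EB psi -> EB (phi + psi).
Proof.
move=> Ep Eq k k0 Z Zp; rewrite ampliation_funD.
by apply: separablemxD; [exact: Ep | exact: Eq].
Qed.

Lemma EBZ d a (phi : 'End('M[C]_d)) : 0 <= a -> EB phi -> EB (a *: phi).
Proof.
move=> a0 Ep k k0 Z Zp; rewrite ampliation_funZ.
by apply: separablemxZ => //; exact: Ep.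
Qed.

Lemma EB_sum d (I : finType) (P : pred I) (F : I -> 'End('M[C]_d)) :
  (forall i, EB (F i)) -> EB (\sum_(i | P i) F i).
Proof. by move=> FE; apply: big_ind => //; [exact: EB0 | exact: EBD]. Qed.

Lemma EB_completely_positive d (phi : 'End('M[C]_d)) :
  EB phi -> completely_positive phi.
Proof. by move=> Ep k k0 Z Zp; apply: separablemx_psd; exact: Ep. Qed.

Lemma sum_mxtens_index d k (V : nmodType) (F : 'I_(d * k) -> V) :
  \sum_p F p = \sum_(a < d) \sum_(i < k) F (mxtens_index (a, i)).
Proof.
rewrite pair_bigA (reindex (@mxtens_index d k)) /=.
  by apply: eq_bigr => -[].
exists (@mxtens_unindex d k) => p _; first exact: mxtens_indexK.
exact: mxtens_unindexK.
Qed.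

(* [Ad (x w)] maps [Z] to [x x^*] tensored with the compression of [Z] along
   the first factor by [w]. *)
Lemma EB_Ad_rank1 d (x : 'cV[C]_d) (w : 'rV[C]_d) : EB (Ad (x *m w)).
Proof.
move=> k k0 Z Zp.
(* [W] is the Kronecker product of [w] with the identity of size [k], so conjugating by it
   compresses the first factor of [Z]. *)
pose W : 'M[C]_(k, d * k) :=
  \matrix_(i, p) (w 0 (mxtens_unindex p).1 *+ ((mxtens_unindex p).2 == i)).
have WE i (G : 'I_(d * k) -> C) :
    \sum_p W i p * G p = \sum_a w 0 a * G (mxtens_index (a, i)).
  rewrite sum_mxtens_index; apply: eq_bigr => a _.
  rewrite (bigD1 i) //= big1 ?addr0 => [|j ji]; rewrite mxE mxtens_indexK /=.
    by rewrite eqxx.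
  by rewrite (negPf ji) mulr0n mul0r.
have WEC i (G : 'I_(d * k) -> C) :
    \sum_p G p * W^t* p i = \sum_a G (mxtens_index (a, i)) * (w 0 a)^*.
  rewrite sum_mxtens_index; apply: eq_bigr => a _.
  rewrite (bigD1 i) //= big1 ?addr0 => [|j ji]; rewrite !mxE mxtens_indexK /=.
    by rewrite eqxx.
  by rewrite (negPf ji) mulr0n rmorph0 mulr0.
exists 1%N, (fun=> x *m x^t*), (fun=> W *m Z *m W^t*); split.
  move=> _; split; last exact: psdmx_conj.
  by rewrite -{1}(trmxCK x); exact: psdmx_gram.
rewrite big_ord1; apply/matrixP => p q.
case: (mxtens_indexP p) => a i; case: (mxtens_indexP q) => b j.
rewrite ampliationE tensmxE AdE adjmxM !mulmxA.
(* The middle product is 1 x 1, so it comes out as a scalar. *)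
have -> : x *m w *m tens_coef Z i j *m w^t* *m x^t*
    = (w *m tens_coef Z i j *m w^t*) 0 0 *: (x *m x^t*).
  rewrite scalemxAl -mul_mx_scalar -mx11_scalar !mulmxA //.
rewrite mxE mulrC; congr (_ * _); rewrite !mxE WEC; apply: eq_bigr => c _.
rewrite !mxE WE; congr (_ * _); apply: eq_bigr => e _.
by rewrite !mxE.
Qed.

(* The Holevo form is read off the Choi matrix [ampliation phi Z] of [phi], for
   [Z] the projector on the (unnormalized) maximally entangled vector. *)
Lemma EB_holevo d (phi : 'End('M[C]_d)) : (0 < d)%N -> EB phi ->
  exists (m : nat) (X Y : 'I_m -> 'M[C]_d),
    (forall j, psdmx (X j) /\ psdmx (Y j)) /\
    forall M, phi M = \sum_j (\sum_a \sum_b M a b * Y j a b) *: X j.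
Proof.
move=> d0 Ep.
pose om : 'rV[C]_(d * d) :=
  \row_p ((mxtens_unindex p).1 == (mxtens_unindex p).2)%:R.
have [m [X [Y [XY phiE]]]] := Ep d d0 _ (psdmx_gram om).
exists m, X, Y; split=> // M.
(* The coefficient of the projector at [(a, b)] is the matrix unit E_ab, so the Choi matrix lists
   the values of [phi] on all matrix units. *)
have phi_delta a b : phi (delta_mx a b) = \sum_j Y j a b *: X j.
  have -> : delta_mx a b = tens_coef (om^t* *m om) a b.
    apply/matrixP => i j; rewrite !mxE big_ord1 !mxE !mxtens_indexK /=.
    by rewrite rmorph_nat -natrM mulnb.
  apply/matrixP => i j; rewrite -ampliationE phiE !summxE.
  by apply: eq_bigr => l _; rewrite tensmxE mxE mulrC.
rewrite {1}(matrix_sum_delta M) linear_sum /=.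
under eq_bigr => a _.
  rewrite linear_sum /=.
  under eq_bigr => b _ do rewrite linearZ /= phi_delta scaler_sumr.
  rewrite exchange_big; over.
rewrite exchange_big; apply: eq_bigr => j _ /=.
rewrite scaler_suml; apply: eq_bigr => a _.
rewrite scaler_suml; apply: eq_bigr => b _.
by rewrite scalerA.
Qed.

(** Split each [X j] and [Y j] of the Holevo form into rank-one terms, one per row of a Gram factor;
    each pair of rows contributes one Kraus operator. *)
Lemma EB_kraus d (phi : 'End('M[C]_d)) : (0 < d)%N -> EB phi ->
  exists (I : finType) (x : I -> 'cV[C]_d) (w : I -> 'rV[C]_d),
    phi = \sum_i Ad (x i *m w i).
Proof.
move=> d0 /(EB_holevo d0)[m [X [Y [XY phiE]]]].
have /fin_all_exists[Q QE] : forall j, exists Q : 'M[C]_d, X j = Q^t* *m Q.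
  by move=> j; apply: psdmx_sqrt; case: (XY j).
have /fin_all_exists[P PE] : forall j, exists Q : 'M[C]_d, Y j = Q^t* *m Q.
  by move=> j; apply: psdmx_sqrt; case: (XY j).
exists ('I_m * ('I_d * 'I_d))%type.
exists (fun i => (row i.2.1 (Q i.1))^t*).
(* The Holevo coefficient pairs [M a b] with [Y j a b], without transposition; conjugating the row
   of [P] turns this pairing into w M w^*. *)
exists (fun i => map_mx Num.conj (row i.2.2 (P i.1))).
apply/lfunP => M; rewrite sum_lfunE phiE.
rewrite -(pair_bigA _ (fun j st => Ad ((row st.1 (Q j))^t* *m
  map_mx Num.conj (row st.2 (P j))) M)) /=; apply: eq_bigr => j _.
rewrite -(pair_bigA _ (fun s t => Ad ((row s (Q j))^t* *m
  map_mx Num.conj (row t (P j))) M)) /=.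
rewrite [RHS]exchange_big /=.
have XjE : X j = \sum_s (row s (Q j))^t* *m row s (Q j).
  rewrite QE; apply/matrixP => a b; rewrite summxE mxE; apply: eq_bigr => s _.
  by rewrite !mxE big_ord1 !mxE.
have YjE a b : Y j a b = \sum_t (P j t a)^* * P j t b.
  by rewrite PE mxE; apply: eq_bigr => t _; rewrite !mxE.
under eq_bigr => a _ do under eq_bigr => b _ do rewrite YjE mulr_sumr.
under eq_bigr => a _ do rewrite exchange_big /=.
rewrite exchange_big /= scaler_suml; apply: eq_bigr => t _.
rewrite XjE scaler_sumr; apply: eq_bigr => s _.
rewrite AdE adjmxM trmxCK.
set c := \sum_a _; set x := (row s _)^t*; set w := map_mx _ (row t (P j)).
suff cE : w *m M *m w^t* = c%:M.
  rewrite !mulmxA -[x *m w *m M]mulmxA -[x *m _ *m _]mulmxA cE.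
  by rewrite mul_mx_scalar -scalemxAl.
rewrite [LHS]mx11_scalar; congr (_%:M).
rewrite mxE /c [RHS]exchange_big; apply: eq_bigr => b _ /=.
rewrite mxE mulr_suml; apply: eq_bigr => a _.
by rewrite !mxE conjCK mulrA [M a b * _]mulrC.
Qed.

(** [F0] asks for rank exactly one, so vanishing Kraus terms have to be set apart. *)
Lemma Ad_rank1_or0 d (x : 'cV[C]_d) (w : 'rV[C]_d) :
  \rank (x *m w) = 1%N \/ Ad (x *m w) = 0.
Proof.
have := mulmx_max_rank x w; case: (\rank _) / (erefl (\rank (x *m w))) => //.
case E: (\rank (x *m w)) => [|[|//]] _; [right | by left].
have /eqP := E; rewrite mxrank_eq0 => /eqP ->.
by apply/lfunP => M; rewrite AdE !mul0mx lfunE.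
Qed.

End EntanglementBreaking.

(** * Arithmetic of real combinations *)

Section RealCombinations.
Variables (R : realType) (V : lmodType R[i]) (n : nat) (v : 'I_n -> V).

Lemma real_comb0 : real_comb (fun=> 0) v = 0.
Proof. by apply: big1 => i _; rewrite scale0r. Qed.

Lemma real_combD c e :
  real_comb c v + real_comb e v = real_comb (fun i => c i + e i) v.
Proof.
by rewrite -big_split; apply: eq_bigr => i _ /=; rewrite rmorphD scalerDl.
Qed.

Lemma real_combZ (a : R) c :
  (a%:C)%C *: real_comb c v = real_comb (fun i => a * c i) v.
Proof.
by rewrite scaler_sumr; apply: eq_bigr => i _; rewrite scalerA -rmorphM.
Qed.

End RealCombinations.

(** * Real relations among the rank-one maps and extremality of [tau] *)

Section Extremality.
Variables (R : realType) (d n : nat) (tau : 'End('M[R[i]]_d)).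
Variable (B : 'I_n -> 'M[R[i]]_d).
Local Notation C := R[i].
Local Notation AdB := (fun k => Ad (B k)).

(** Each nonzero Kraus term of [phi] is itself in [F0 tau]: subtracting it from [tau] leaves
    [tau - phi] plus the other Kraus terms, a sum of EB maps. *)
Lemma EB_below_real_comb (phi : 'End('M[C]_d)) : (0 < d)%N ->
  real_basis (real_span (F0 tau)) AdB ->
  EB phi -> EB (tau - phi) -> exists c : 'I_n -> R, phi = real_comb c AdB.
Proof.
move=> d0 [_ _ Bspan] Ep Etp; have Et : EB tau.
  by rewrite -(subrK phi tau); exact: EBD.
have [I [x [w phiE]]] := EB_kraus d0 Ep.
have term i : exists c : 'I_n -> R, Ad (x i *m w i) = real_comb c AdB.
  have [r1|->] := Ad_rank1_or0 (x i) (w i); last first.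
    by exists (fun=> 0); rewrite real_comb0.
  apply: Bspan; exists 1%N, (fun=> 1), (fun=> Ad (x i *m w i)); split.
    move=> _; exists (x i *m w i) => //; split=> //.
    split=> //; first exact: EB_Ad_rank1.
    have phiD : phi = Ad (x i *m w i) + \sum_(j | j != i) Ad (x j *m w j).
      by rewrite phiE (bigD1 i).
    have -> : tau - Ad (x i *m w i)
        = tau - phi + \sum_(j | j != i) Ad (x j *m w j).
      by rewrite phiD opprD addrA subrK.
    by apply: EBD => //; apply: EB_sum => j; exact: EB_Ad_rank1.
  by rewrite /real_comb big_ord1 scale1r.
rewrite phiE.
apply: (big_ind (fun psi => exists c, psi = real_comb c AdB)) => //.
- by exists (fun=> 0); rewrite real_comb0.
- by move=> _ _ [c ->] [e ->]; exists (fun i => c i + e i); rewrite real_combD.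
Qed.

Lemma real_combE c (X : 'M[C]_d) :
  real_comb c AdB X = \sum_k (c k)%:C%C *: (B k *m X *m (B k)^t*).
Proof. by rewrite sum_lfunE; apply: eq_bigr => k _; rewrite lfunE /= AdE. Qed.

(** By cyclicity of the trace. The matrix multiplying [X] is the image of the identity under the
    Hilbert-Schmidt adjoint of the combination. *)
Lemma mxtrace_real_comb c (X : 'M[C]_d) :
  \tr (real_comb c AdB X)
  = \tr ((\sum_k (c k)%:C%C *: ((B k)^t* *m B k)) *m X).
Proof.
rewrite real_combE mulmx_suml !linear_sum /=; apply: eq_bigr => k _.
by rewrite -scalemxAl !mxtraceZ mxtrace_mulC mulmxA.
Qed.

Lemma mxtrace_mul_eq0 (A : 'M[C]_d) : (forall X, \tr (A *m X) = 0) -> A = 0.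
Proof.
move=> A0; apply/matrixP => i j; rewrite mxE -[RHS](A0 (delta_mx j i)).
rewrite /mxtrace (bigD1 i) //= big1 ?addr0 => [|k ki].
  rewrite mxE (bigD1 j) //= big1 ?addr0 => [|l lj]; rewrite mxE.
    by rewrite !eqxx mulr1.
  by rewrite (negPf lj) mulr0.
by rewrite mxE big1 // => l _; rewrite mxE (negPf ki) andbF mulr0.
Qed.


Lemma sum_scale_pair (c : 'I_n -> C) (X Y : 'I_n -> 'M[C]_d) :
  \sum_k c k *: (X k, Y k) = (\sum_k c k *: X k, \sum_k c k *: Y k).
Proof.
by apply/pair_eqP/andP; split; apply/eqP;
  [exact: (big_morph fst (op1 := +%R) (id1 := 0))
  |exact: (big_morph snd (op1 := +%R) (id1 := 0))].
Qed.

(** Pairs encode the direct sum of two copies of the matrix algebra; the first component controls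
    unitality, the second the trace. *)
Lemma real_comb_pair c :
  \sum_k (c k)%:C%C *: (B k *m (B k)^t*, (B k)^t* *m B k) =
  (real_comb c AdB 1%:M, \sum_k (c k)%:C%C *: ((B k)^t* *m B k)).
Proof.
by rewrite sum_scale_pair real_combE; under [in RHS]eq_bigr do rewrite mulmx1.
Qed.

Lemma hermitian_comb_conj (c : 'I_n -> C) (H : 'I_n -> 'M[C]_d) :
  (forall k, (H k)^t* = H k) ->
  \sum_k c k *: H k = 0 -> \sum_k (c k)^* *: H k = 0.
Proof.
move=> Hh /(congr1 (fun A : 'M[C]_d => A^t*)); rewrite adjmx_sum trmx0 map_mx0.
by under eq_bigr do rewrite adjmxZ Hh.
Qed.

(** The factor 1/n shares [tau] equally among the [n] terms, so that each [Ad (B k)] is compensated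
    by its own copy of [tau]. *)
Lemma UEBTP_perturb c : UEBTP tau -> (forall k, F0 tau (Ad (B k))) ->
  (forall k, `|c k| <= 1) ->
  \sum_k (c k)%:C%C *: (B k *m (B k)^t*, (B k)^t* *m B k) = 0 ->
  UEBTP (tau + n%:R^-1 *: real_comb c AdB).
Proof.
move=> [[_ TPtau] Utau EBtau] BF0 c1; rewrite real_comb_pair => -[c_unit c_tr].
have EBp : EB (tau + n%:R^-1 *: real_comb c AdB).
  case: (posnP n) => [n0|n0].
    (* The inverse of zero is zero, so nothing is added when [n] is 0. *)
    have -> : n%:R^-1 = 0 :> C by rewrite n0 invr0.
    by rewrite scale0r addr0.
  (* Every summand is EB: [Ad (B k)] lies below [tau], and 1 + c_k is nonnegative. *)
  have -> : tau + n%:R^-1 *: real_comb c AdB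
      = n%:R^-1 *: \sum_k (tau - Ad (B k) + (1 + c k)%:C%C *: Ad (B k)).
    under eq_bigr do rewrite rmorphD scalerDl scale1r addrA subrK.
    rewrite big_split /= sumr_const card_ord scalerDr -[tau *+ n]scaler_nat scalerA.
    by rewrite mulVf ?scale1r // pnatr_eq0 -lt0n.
  apply: EBZ; first by rewrite invr_ge0 ler0n.
  apply: EB_sum => k; have [B' [_ [EBB _ EBtB]] <-] := BF0 k.
  apply: EBD => //; apply: EBZ => //; rewrite ler0c.
  by have := c1 k; rewrite ler_norml -subr_ge0 opprK addrC => /andP[].
split=> //; first split.
- exact: EB_completely_positive.
- move=> X; rewrite !lfunE /= lfunE /= mxtraceD mxtraceZ mxtrace_real_comb.
  by rewrite c_tr mul0mx mxtrace0 mulr0 addr0 TPtau.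
- by rewrite /unital !lfunE /= lfunE /= c_unit scaler0 addr0.
Qed.

Lemma extreme_real_free : UEBTP tau -> (forall k, F0 tau (Ad (B k))) ->
  real_basis (real_span (F0 tau)) AdB -> extreme_point (@UEBTP R d) tau ->
  forall c : 'I_n -> R,
    \sum_k (c k)%:C%C *: (B k *m (B k)^t*, (B k)^t* *m B k) = 0 ->
    forall k, c k = 0.
Proof.
move=> Htau BF0 [_ Bfree _] [_ extr] c c_eq0 k.
(* Dividing by [s] brings all coefficients into [-1, 1]; the 1 keeps [s] positive. *)
pose s := 1 + \sum_i `|c i|.
have s_gt0 : 0 < s by rewrite ltr_pwDl // sumr_ge0.
have c_le_s i : `|s^-1 * c i| <= 1.
  rewrite normrM ger0_norm ?invr_ge0 ?(ltW s_gt0) // mulrC ler_pdivrMr // mul1r.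
  by rewrite /s (bigD1 i) //= addrCA lerDl addr_ge0 ?sumr_ge0.
pose D := real_comb (fun i => s^-1 * c i) AdB.
have UD (e : R) : `|e| = 1 -> UEBTP (tau + n%:R^-1 *: (e%:C%C *: D)).
  move=> e1; rewrite real_combZ; apply: UEBTP_perturb => // [i|].
    by rewrite normrM e1 mul1r.
  under eq_bigr do rewrite !rmorphM -!scalerA.
  by rewrite -!scaler_sumr c_eq0 !scaler0.
have half : 0 < (2^-1 : R) < 1 by rewrite invr_gt0 ltr0n invf_lt1 ?ltr1n ?ltr0n.
have halves : 2^-1 + 2^-1 = 1 :> R by rewrite [RHS]splitr mul1r.
(* [tau] is the midpoint of its perturbations by +D/n and -D/n, so extremality forces D/n = 0. *)
have [|tauD _] := extr _ _ _ (UD 1 (normr1 _)) (UD (-1) (normrN1 _)) half.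
  have -> : 1 - 2^-1 = 2^-1 :> R by rewrite -{1}halves addrK.
  rewrite -scalerDr rmorph1 scale1r rmorphN1 scaleN1r scalerN addrACA subrr addr0.
  by rewrite scalerDr -scalerDl -rmorphD halves rmorph1 scale1r.
have /eqP : n%:R^-1 *: D = 0.
  by apply: (addrI tau); rewrite addr0 -[RHS]tauD rmorph1 scale1r.
(* The case n = 0 is excluded by the index [k]. *)
rewrite scaler_eq0 invr_eq0 pnatr_eq0 => /orP[/eqP n0|/eqP /Bfree/(_ k)/eqP].
  by have := ltn_ord k; rewrite {2}n0.
by rewrite mulf_eq0 invr_eq0 gt_eqF //= => /eqP.
Qed.

(* The operators are Hermitian, so a complex relation conjugates to another
   one and splits into real ones. *)
Lemma complex_free_of_real :
  (forall c : 'I_n -> R,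
    \sum_k (c k)%:C%C *: (B k *m (B k)^t*, (B k)^t* *m B k) = 0 ->
    forall k, c k = 0) ->
  free [tuple (B k *m (B k)^t*, (B k)^t* *m B k) | k < n].
Proof.
move=> rfree; apply/freeP => c.
under eq_bigr do rewrite -tnth_nth tnth_mktuple.
move=> c_eq0 k.
have cJ_eq0 : \sum_k (c k)^* *: (B k *m (B k)^t*, (B k)^t* *m B k) = 0.
  move: c_eq0; rewrite !sum_scale_pair => -[c_eq0l c_eq0r].
  by congr pair; apply: hermitian_comb_conj => // i; rewrite adjmxM trmxCK.
have Re0 : complex.Re (c k) = 0.
  apply: (rfree (fun k => complex.Re (c k))).
  under eq_bigr do rewrite ReJ_add mulrC -scalerA scalerDl.
  by rewrite -scaler_sumr big_split /= c_eq0 cJ_eq0 addr0 scaler0.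
have Im0 : complex.Im (c k) = 0.
  apply: (rfree (fun k => complex.Im (c k))).
  under eq_bigr do rewrite ImJ_sub -mulrA mulrC -scalerA scalerBl.
  by rewrite -scaler_sumr sumrB c_eq0 cJ_eq0 subr0 scaler0.
by apply/eqP; rewrite eq_complex Re0 Im0 !eqxx.
Qed.

Lemma free_extreme : UEBTP tau ->
  real_basis (real_span (F0 tau)) AdB ->
  free [tuple (B k *m (B k)^t*, (B k)^t* *m B k) | k < n] ->
  extreme_point (@UEBTP R d) tau.
Proof.
move=> Htau Bbasis /freeP Bfree; split=> // y z t Hy Hz /andP[t0 t1] tauE.
suff yz : y = z.
  rewrite tauE yz -scalerDl -rmorphD addrC subrK rmorph1 scale1r.
  by split.
(* The Kraus form needs d > 0; for d = 0 any two maps coincide. *)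
case: (posnP d) => [d0|d0].
  by apply/lfunP => X; apply/matrixP => i; have := ltn_ord i; rewrite {2}d0.
have [[[_ TPy] Uy EBy] [[_ TPz] Uz EBz]] := (Hy, Hz).
have t1' : 0 < 1 - t by rewrite subr_gt0.
(* The complement of [t y] in [tau] is [(1 - t) z], which is EB, and symmetrically for [z] below. *)
have [cy cyE] : exists c, t%:C%C *: y = real_comb c AdB.
  apply: EB_below_real_comb => //; first by apply: EBZ; rewrite ?ler0c ?ltW.
  by rewrite tauE addrAC subrr add0r; apply: EBZ; rewrite ?ler0c ?ltW.
have [cz czE] : exists c, (1 - t)%:C%C *: z = real_comb c AdB.
  apply: EB_below_real_comb => //; first by apply: EBZ; rewrite ?ler0c ?ltW.
  by rewrite tauE addrK; apply: EBZ; rewrite ?ler0c ?ltW.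
have [c cE] : exists c, y - z = real_comb c AdB.
  have yE : y = t^-1%:C%C *: real_comb cy AdB.
    by rewrite -cyE scalerA -rmorphM mulVf ?gt_eqF // scale1r.
  have zE : - z = (- (1 - t)^-1)%:C%C *: real_comb cz AdB.
    by rewrite -czE scalerA -rmorphM mulNr mulVf ?gt_eqF // rmorphN1 scaleN1r.
  by eexists; rewrite zE yE !real_combZ real_combD.
apply/eqP; rewrite -subr_eq0 cE; apply/eqP.
suff c0 k : c k = 0.
  by rewrite /real_comb big1 // => k _; rewrite c0 scale0r.
apply: (@complexI R); apply: (Bfree (fun i => (c i)%:C%C)).
under eq_bigr do rewrite -tnth_nth tnth_mktuple.
(* Unitality of [y] and [z] kills the first component; trace preservation kills the second, tested
   against all [X]. *)
rewrite real_comb_pair -cE !lfunE /= lfunE /= Uy Uz subrr; congr pair.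
apply: mxtrace_mul_eq0 => X; rewrite -mxtrace_real_comb -cE.
by rewrite !lfunE /= lfunE /= raddfB /= TPy TPz subrr.
Qed.

End Extremality.

Theorem theorem3p1 (R : realType) (d : nat) (tau : 'End('M[R[i]]_d))
    (Htau : UEBTP tau) (n : nat) (B : 'I_n -> 'M[R[i]]_d)
    (BF0 : forall k, F0 tau (Ad (B k)))
    (Bbasis : real_basis (real_span (F0 tau)) (fun k => Ad (B k))) :
  extreme_point (@UEBTP R d) tau <->
  free [tuple (B k *m (B k)^t*, (B k)^t* *m B k) | k < n].
Proof.
split; last exact: free_extreme.
by move=> extr; apply: complex_free_of_real; exact: (extreme_real_free Htau BF0 Bbasis extr).
Qed.
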